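(* Let $G=(V,q)$ be a reversible connected graph with non-negative Ollivier curvature. Then for all $f\in\ell_\infty(V)$ and $t>0$, \[ \|\nabla P_tf\|_\infty\le\frac{\|f\|_\infty}{\sqrt{t\,q_{\min}}}. \]
   Context: A graph $G=(V,q)$ consists of a countable set $V$ and a function $q:V\times V\to[0,\infty)$ such that $\#\{y:q(x,y)>0\}<\infty$ for every $x\in V$; its Laplacian is $\Delta f(x)=\sum_y q(x,y)(f(y)-f(x))$. $G$ is reversible if there is $m:V\to(0,\infty)$ with $q(x,y)m(x)=q(y,x)m(y)$. For reversible $G$, $d$ is the combinatorial graph distance (finite since $G$ is connected). $q_{\min}:=\inf\{q(x,y):q(x,y)>0\}$. $\ell_\infty(V)$ is the space of bounded functions with sup norm. Ollivier curvature: for $x\ne y$ let $\nabla_{xy}f=(f(x)-f(y))/d(x,y)$, $\|\nabla f\|_\infty=\sup_{x\ne y}|\nabla_{xy}f|$, $\kappa(x,y)=\inf\{\nabla_{xy}\Delta f:\|\nabla f\|_\infty=1,\ \nabla_{yx}f=1\}$; non-negative Ollivier curvature means $\kappa(x,y)\ge0$ for all $x\ne y$. Heat semigroup: for finite $S$ let $q_S(x,y)=q(x,y)1_S(x)$ with Laplacian $\Delta_S$ and $P^S_tf=\sum_{k\ge0}t^k\Delta_S^k(f1_S)/k!$; for $f\in\ell_\infty(V)$, $P_tf=\lim_iP_t^{S_i}f$ pointwise along any increasing exhaustion of $V$ by finite sets. *)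

(* Defs.v *)
From Stdlib Require Import Reals Lra List Arith ClassicalEpsilon.
Open Scope R_scope.

Section Graph.
Context {V : Type}.

(* A weighted graph (V,q).  [N x] is the (duplicate-free) list of the
   finitely many y with q(x,y) > 0 (local finiteness). *)
Definition neighbour_list (q : V -> V -> R) (N : V -> list V) : Prop :=
  forall x, NoDup (N x) /\ (forall y, In y (N x) <-> q x y > 0).

Definition lap (q : V -> V -> R) (N : V -> list V) (f : V -> R) (x : V) : R :=
  fold_right Rplus 0 (map (fun y => q x y * (f y - f x)) (N x)).

Definition reversible (q : V -> V -> R) : Prop :=
  exists m : V -> R, (forall x, 0 < m x) /\
    (forall x y, q x y * m x = q y x * m y).

Inductive reach (q : V -> V -> R) : nat -> V -> V -> Prop :=
| reach0 : forall x, reach q 0 x x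
| reachS : forall n x y z, reach q n x y -> q y z > 0 -> reach q (S n) x z.

Definition connected (q : V -> V -> R) : Prop :=
  forall x y, exists n, reach q n x y.

Definition is_dist (q : V -> V -> R) (x y : V) (n : nat) : Prop :=
  reach q n x y /\ (forall k, reach q k x y -> (n <= k)%nat).

Definition dist (q : V -> V -> R) (x y : V) : nat :=
  epsilon (inhabits 0%nat) (is_dist q x y).

Definition grad (q : V -> V -> R) (f : V -> R) (x y : V) : R :=
  (f x - f y) / INR (dist q x y).

(* the set {|∇_{xy} f| : x ≠ y}, whose supremum is ‖∇f‖_∞ *)
Definition grad_vals (q : V -> V -> R) (f : V -> R) (r : R) : Prop :=
  exists x y, x <> y /\ r = Rabs (grad q f x y).

(* the set {∇_{xy}Δf : ‖∇f‖_∞ = 1, ∇_{yx} f = 1}, whose infimum is κ(x,y) *)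
Definition curv_set (q : V -> V -> R) (N : V -> list V) (x y : V) (r : R) : Prop :=
  exists f : V -> R, is_lub (grad_vals q f) 1 /\ grad q f y x = 1 /\
    r = grad q (lap q N f) x y.

(* κ(x,y) = inf curv_set ≥ 0 for all x ≠ y *)
Definition nonneg_ollivier (q : V -> V -> R) (N : V -> list V) : Prop :=
  forall x y, x <> y -> forall r, curv_set q N x y r -> 0 <= r.

Definition is_glb (E : R -> Prop) (m : R) : Prop :=
  (forall r, E r -> m <= r) /\ (forall b, (forall r, E r -> b <= r) -> b <= m).

Definition is_qmin (q : V -> V -> R) (m : R) : Prop :=
  is_glb (fun r => exists x y, q x y > 0 /\ r = q x y) m.

Definition ind (S : V -> bool) (f : V -> R) : V -> R :=
  fun x => if S x then f x else 0.

(* Δ_S, the Laplacian of q_S(x,y) = q(x,y) 1_S(x) *)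
Definition lapS (q : V -> V -> R) (N : V -> list V) (S : V -> bool)
  (f : V -> R) : V -> R :=
  fun x => if S x then lap q N f x else 0.

Definition heat_term (q : V -> V -> R) (N : V -> list V) (S : V -> bool)
  (t : R) (f : V -> R) (x : V) (k : nat) : R :=
  t ^ k / INR (Factorial.fact k) * Nat.iter k (lapS q N S) (ind S f) x.

Definition heatS (q : V -> V -> R) (N : V -> list V) (S : V -> bool)
  (t : R) (f : V -> R) (x : V) : R :=
  epsilon (inhabits 0) (fun l => infinite_sum (heat_term q N S t f x) l).

Definition finite_set (S : V -> bool) : Prop :=
  exists l : list V, forall x, S x = true -> In x l.

Definition exhaustion (Sq : nat -> V -> bool) : Prop :=
  (forall i, finite_set (Sq i)) /\
  (forall i x, Sq i x = true -> Sq (S i) x = true) /\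
  (forall x, exists i, Sq i x = true).

Definition countable_type : Prop :=
  exists c : V -> nat, forall x y, c x = c y -> x = y.

End Graph.

(* Main.v *)
From Stdlib Require Import Reals List Lra Lia Psatz Classical ClassicalEpsilon Wf_nat Factorial.
From Coquelicot Require Import Coquelicot.
Require Import Defs.
Open Scope R_scope.

(** Two-point maximum principle.  For the Dirichlet heat flow [u] of [f] on a large
    finite set one shows
      [u t x - u t y <= phi (d x y) t + eps * (d o x + d o y + (2 D + 1) t)],
    where [phi] is concave in the distance and a supersolution of the heat equation
    on the half-line with jump rate [2 qmin] to each neighbour, killed at [0], and
    initially equal to [2 ‖f‖] off [0].  At a maximal pair [u] is controlled by a
    function which is Lipschitz with constant the forward slope of [phi]; curvature
    orders its Laplacians at the two points, and the two end edges of a geodesic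
    supply the second difference of [phi].  The penalty in [eps] makes the maximum
    exist: curvature gives [lap (d o) <= D], so no bound on the vertex degrees is
    needed.  Exhausting [V] and then letting [eps] tend to [0] leaves
    [phi n t <= n ‖f‖ / sqrt (t qmin)]. *)

(** * Finite sums and minima *)

Definition lsum {A : Type} (F : A -> R) (l : list A) : R :=
  fold_right Rplus 0 (map F l).

Lemma lsum_le {A : Type} (F G : A -> R) (l : list A) :
  (forall a, In a l -> F a <= G a) -> lsum F l <= lsum G l.
Proof.
  unfold lsum; induction l as [|b l IH]; simpl; intros H; [lra|].
  apply Rplus_le_compat; auto.
Qed.

(** Serves to collect the surplus [c] carried by one edge when Laplacians are compared termwise. *)
Lemma lsum_le_gap {A : Type} (F G : A -> R) (l : list A) (a0 : A) (c : R) :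
  (forall a, In a l -> F a <= G a) -> In a0 l -> F a0 + c <= G a0 ->
  lsum F l + c <= lsum G l.
Proof.
  induction l as [|b l IH]; simpl; intros H H0 Hc; [tauto|].
  unfold lsum in *; simpl.
  destruct H0 as [->|H0].
  - assert (E : lsum F l <= lsum G l) by (apply lsum_le; auto).
    unfold lsum in E; lra.
  - assert (E := IH (fun a h => H a (or_intror h)) H0 Hc).
    assert (F b <= G b) by auto. lra.
Qed.

Lemma lsum_lin {A : Type} (F G : A -> R) (c : R) (l : list A) :
  lsum (fun a => F a + c * G a) l = lsum F l + c * lsum G l.
Proof.
  unfold lsum; induction l as [|b l IH]; simpl; [ring|]. rewrite IH; ring.
Qed.

Lemma lsum_const {A : Type} (c : R) (l : list A) :
  lsum (fun _ => c) l = c * INR (length l).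
Proof.
  unfold lsum; induction l as [|b l IH]; simpl map; simpl fold_right; [simpl; ring|].
  rewrite IH. simpl length. rewrite S_INR. ring.
Qed.

Lemma lsum_ext {A : Type} (F G : A -> R) (l : list A) :
  (forall a, In a l -> F a = G a) -> lsum F l = lsum G l.
Proof. intros H; apply Rle_antisym; apply lsum_le; intros a Ha; rewrite (H a Ha); lra. Qed.

Definition lmin {A : Type} (F : A -> R) (a : A) (l : list A) : R :=
  fold_right (fun b m => Rmin (F b) m) (F a) l.

Lemma lmin_le {A : Type} (F : A -> R) (a : A) (l : list A) (b : A) :
  In b (a :: l) -> lmin F a l <= F b.
Proof.
  unfold lmin; induction l as [|c l IH]; simpl; intros H.
  - destruct H as [->|[]]; lra.
  - destruct H as [H|[H|H]].
    + eapply Rle_trans; [apply Rmin_r|]. apply IH; simpl; auto.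
    + subst; apply Rmin_l.
    + eapply Rle_trans; [apply Rmin_r|]. apply IH; simpl; auto.
Qed.

Lemma lmin_ge {A : Type} (F : A -> R) (a : A) (l : list A) (c : R) :
  (forall b, In b (a :: l) -> c <= F b) -> c <= lmin F a l.
Proof.
  unfold lmin; induction l as [|d l IH]; simpl; intros H; [auto|].
  apply Rmin_glb; [auto|]. apply IH; simpl; intuition.
Qed.

(** * A maximum principle for finite families *)

Lemma finite_family_max {P : Type} (l : list P) (F : P -> R -> R) (T : R) :
  0 <= T -> l <> nil ->
  (forall p t, In p l -> 0 <= t <= T -> continuity_pt (F p) t) ->
  exists p t, In p l /\ 0 <= t <= T /\
    forall p' t', In p' l -> 0 <= t' <= T -> F p' t' <= F p t.
Proof.
  intros HT; induction l as [|a l IH]; intros Hne Hc; [congruence|].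
  destruct (continuity_ab_maj (F a) 0 T HT) as [ta [Hta Hta']].
  { intros c Hc'; apply Hc; simpl; auto. }
  destruct l as [|b l].
  - exists a, ta; simpl; intuition; subst; auto.
  - destruct IH as [p [t [Hp [Ht Hm]]]]; [congruence|intros; apply Hc; simpl in *; auto|].
    destruct (Rle_dec (F a ta) (F p t)) as [Hle|Hgt].
    + exists p, t; split; [simpl in *; tauto|split; [auto|]].
      intros p' t' [<-|Hp'] Ht'; [|auto].
      apply Rle_trans with (F a ta); auto.
    + exists a, ta; split; [simpl; auto|split; [auto|]].
      intros p' t' [<-|Hp'] Ht'; [auto|].
      apply Rle_trans with (F p t); [auto|lra].
Qed.

(** Only times before [t] are compared, so that a maximum over [[0, T]] attained at the endpoint [T]
    is covered. *)
Lemma derivative_nonneg_at_left_max (F : R -> R) (t l : R) :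
  0 < t -> (forall s, 0 <= s <= t -> F s <= F t) -> derivable_pt_lim F t l -> 0 <= l.
Proof.
  intros Ht Hm Hd. destruct (Rle_dec 0 l) as [|Hl]; [auto|exfalso].
  destruct (Hd (- l)) as [[de Hde] Hlim]; [lra|]; simpl in Hlim.
  set (h := - Rmin (de / 2) t).
  assert (Hmin : 0 < Rmin (de / 2) t) by (apply Rmin_pos; lra).
  assert (Rmin (de / 2) t <= t) by apply Rmin_r.
  assert (Rmin (de / 2) t <= de / 2) by apply Rmin_l.
  assert (Hh : h <> 0) by (unfold h; lra).
  specialize (Hlim h Hh).
  assert (Hq : 0 <= (F (t + h) - F t) / h).
  { replace ((F (t + h) - F t) / h) with ((F t - F (t + h)) / (- h)) by (field; lra).
    assert (F (t + h) <= F t) by (apply Hm; unfold h; lra).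
    apply Rmult_le_pos; [lra|]. left; apply Rinv_0_lt_compat; unfold h; lra. }
  assert (Hab : Rabs h < de) by (unfold h; rewrite Rabs_Ropp, Rabs_right; lra).
  apply Hlim in Hab. apply Rabs_def2 in Hab. lra.
Qed.

(** A positive maximum over space and time cannot sit at time [0], so its time derivative is
    nonnegative, against the third hypothesis. That hypothesis concerns only indices that are
    maximal at their own time. *)
Lemma finite_max_principle {P : Type} (l : list P) (F F' : P -> R -> R) (T : R) :
  (forall p t, In p l -> 0 <= t <= T -> derivable_pt_lim (F p) t (F' p t)) ->
  (forall p, In p l -> F p 0 <= 0) ->
  (forall p t, In p l -> 0 < t <= T -> 0 < F p t ->
     (forall p', In p' l -> F p' t <= F p t) -> F' p t < 0) ->
  forall p t, In p l -> 0 <= t <= T -> F p t <= 0.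
Proof.
  intros Hd H0 Hneg p0 t0 Hp0 Ht0.
  destruct (Rle_dec (F p0 t0) 0) as [|Hpos]; [auto|exfalso].
  destruct (finite_family_max l F T) as [p [t [Hp [Ht Hm]]]].
  - lra.
  - intros ->; destruct Hp0.
  - intros p t Hp Ht. apply derivable_continuous_pt. exists (F' p t). apply Hd; auto.
  - assert (Hp0' := Hm p0 t0 Hp0 Ht0).
    assert (Htp : 0 < t).
    { destruct (Rle_lt_or_eq_dec 0 t) as [|E]; [lra|auto|].
      subst t. specialize (H0 p Hp). lra. }
    assert (F' p t < 0).
    { apply Hneg; auto; lra. }
    assert (0 <= F' p t); [|lra].
    apply (derivative_nonneg_at_left_max (F p) t); [auto| |apply Hd; auto].
    intros s Hs; apply Hm; auto; lra.
Qed.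

(** * Distance *)

Section Dist.
Context {V : Type} (q : V -> V -> R).
Context (Hsym : forall x y, q x y > 0 -> q y x > 0).
Context (Hconn : connected q).

Notation d := (dist q).

Lemma dist_spec x y : is_dist q x y (d x y).
Proof.
  unfold dist. apply epsilon_spec.
  destruct (Hconn x y) as [n Hn].
  destruct (dec_inh_nat_subset_has_unique_least_element (fun k => reach q k x y))
    as [m [[Hm Hmin] _]]; [intros; apply classic|eauto|].
  exists m; split; auto.
Qed.

Lemma dist_le n x y : reach q n x y -> (d x y <= n)%nat.
Proof. apply dist_spec. Qed.

Lemma reach_trans n m x y z : reach q n x y -> reach q m y z -> reach q (n + m) x z.
Proof.
  intros H1 H2; revert H1; induction H2 as [y|m y z z' H IH Hz]; intros H1.
  - now rewrite Nat.add_0_r.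
  - rewrite Nat.add_succ_r. eapply reachS; eauto.
Qed.

Lemma reach_edge x y : q x y > 0 -> reach q 1 x y.
Proof. intros H. apply (reachS q 0 x x y); [constructor|auto]. Qed.

Lemma reach_sym n x y : reach q n x y -> reach q n y x.
Proof.
  induction 1 as [x|n x y z H IH Hz]; [constructor|].
  replace (S n) with (1 + n)%nat by reflexivity.
  eapply reach_trans; [apply reach_edge, Hsym, Hz|auto].
Qed.

Lemma dist_sym x y : d x y = d y x.
Proof. apply Nat.le_antisymm; apply dist_le, reach_sym, dist_spec. Qed.

Lemma dist_triangle x y z : (d x z <= d x y + d y z)%nat.
Proof. apply dist_le, reach_trans with y; apply dist_spec. Qed.

Lemma dist_refl x : d x x = 0%nat.
Proof. assert (H : (d x x <= 0)%nat) by (apply dist_le; constructor). lia. Qed.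

Lemma dist_pos x y : x <> y -> (0 < d x y)%nat.
Proof.
  intros H. destruct (d x y) eqn:E; [|lia].
  destruct (dist_spec x y) as [Hr _]. rewrite E in Hr. inversion Hr; congruence.
Qed.

Lemma dist_edge x y : q x y > 0 -> (d x y <= 1)%nat.
Proof. intros H; apply dist_le, reach_edge, H. Qed.

Lemma geodesic_last_step x y :
  x <> y -> exists z, q y z > 0 /\ (d x z + 1 <= d x y)%nat.
Proof.
  intros Hne. destruct (dist_spec x y) as [Hr _].
  inversion Hr as [|n a z b H Hz E]; subst; [congruence|].
  exists z; split; [apply Hsym, Hz|]. apply dist_le in H. lia.
Qed.

(** Stepping back along a geodesic, each point other than [o] of the ball of radius [n + 1] is a
    neighbour of a point of the ball of radius [n]; local finiteness does the rest. *)
Lemma finite_ball (N : V -> list V) (HN : neighbour_list q N) (o : V) (n : nat) :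
  exists l, forall x, (d o x <= n)%nat -> In x l.
Proof.
  induction n as [|n [l Hl]].
  - exists (o :: nil). intros x Hx. destruct (classic (o = x)) as [->|Hne]; [simpl; auto|].
    apply dist_pos in Hne; lia.
  - exists (o :: flat_map N l). intros x Hx.
    destruct (classic (o = x)) as [->|Hne]; [simpl; auto|right].
    destruct (geodesic_last_step o x Hne) as [z [Hz Hd]].
    apply in_flat_map. exists z; split; [apply Hl; lia|].
    apply HN, Hsym, Hz.
Qed.

End Dist.

(** * Laplacian and curvature *)

Section Curvature.
Context {V : Type} (q : V -> V -> R) (N : V -> list V).
Context (Hq : forall x y, 0 <= q x y) (HN : neighbour_list q N).

Lemma lap_lsum f x : lap q N f x = lsum (fun y => q x y * (f y - f x)) (N x).
Proof. reflexivity. Qed.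

Lemma lap_lin f g c x :
  lap q N (fun z => f z + c * g z) x = lap q N f x + c * lap q N g x.
Proof.
  rewrite !lap_lsum, <- lsum_lin. apply lsum_ext; intros; ring.
Qed.

Lemma lap_le f g x :
  (forall y, q x y > 0 -> f y - f x <= g y - g x) -> lap q N f x <= lap q N g x.
Proof.
  intros H; rewrite !lap_lsum; apply lsum_le; intros y Hy.
  apply HN in Hy. apply Rmult_le_compat_l; auto.
Qed.

Lemma lap_le_gap f g x z c :
  (forall y, q x y > 0 -> f y - f x <= g y - g x) ->
  q x z > 0 -> f z - f x + c <= g z - g x ->
  lap q N f x + q x z * c <= lap q N g x.
Proof.
  intros H Hz Hc; rewrite !lap_lsum; apply lsum_le_gap with z.
  - intros y Hy. apply HN in Hy. apply Rmult_le_compat_l; auto.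
  - apply HN; auto.
  - rewrite <- Rmult_plus_distr_l. apply Rmult_le_compat_l; auto.
Qed.

Lemma lap_const c x : lap q N (fun _ => c) x = 0.
Proof.
  rewrite lap_lsum, (lsum_ext _ (fun _ => 0)), lsum_const; intros; ring.
Qed.

Lemma lap_scal c g x : lap q N (fun z => c * g z) x = c * lap q N g x.
Proof.
  transitivity (lap q N (fun z => 0 + c * g z) x).
  - rewrite !lap_lsum; apply lsum_ext; intros; ring.
  - rewrite lap_lin, lap_const; ring.
Qed.

Context (Hsym : forall x y, q x y > 0 -> q y x > 0).
Context (Hconn : connected q) (Hcurv : nonneg_ollivier q N).

Notation d x y := (INR (dist q x y)).

Lemma dist_triangle_R x y z : d x z <= d x y + d y z.
Proof. rewrite <- plus_INR. apply le_INR, dist_triangle; auto. Qed.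

Lemma dist_pos_R x y : x <> y -> 1 <= d x y.
Proof. intros H; apply (le_INR 1), dist_pos; auto. Qed.

(** Dividing [g] by [s] gives a test function for the curvature of [(y, x)]: its gradient norm is
    exactly [1] because the pair [(x, y)] attains the Lipschitz bound. *)
Lemma curvature_lap_le g s x y :
  0 <= s -> x <> y -> (forall a b, g a - g b <= s * d a b) ->
  g x - g y = s * d x y -> lap q N g x <= lap q N g y.
Proof.
  intros Hs Hne Hlip Htight.
  assert (Hd := dist_pos_R x y Hne).
  destruct (Rle_lt_or_eq_dec 0 s Hs) as [Hpos|<-].
  (* For [s = 0] no normalisation is possible, but then [g] is constant and both Laplacians are
     compared with [0]. *)
  2:{ assert (Hc : forall a b, g a - g b <= 0) by (intros a b; specialize (Hlip a b); lra).
      apply Rle_trans with (lap q N (fun _ => 0) x);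
        [|rewrite lap_const, <- (lap_const 0 y)]; apply lap_le; intros z _; [|].
      - specialize (Hc z x); lra.
      - specialize (Hc y z); lra. }
  set (h := fun z => / s * g z).
  assert (Hxy : grad q h x y = 1).
  { unfold grad, h. rewrite <- Rmult_minus_distr_l, Htight. field; lra. }
  assert (Hr : 0 <= grad q (lap q N h) y x).
  { apply (Hcurv y x); [auto|]. exists h; split; [split|split; auto].
    - intros r [a [b [Hab ->]]]. assert (Hd' := dist_pos_R a b Hab).
      unfold grad, h. rewrite <- Rmult_minus_distr_l.
      assert (Hb : Rabs (g a - g b) <= s * d a b).
      { apply Rabs_le; split; [|apply Hlip].
        specialize (Hlip b a). rewrite (dist_sym q Hsym Hconn b a) in Hlip. lra. }
      rewrite Rabs_div, Rabs_mult, (Rabs_right (/ s)), (Rabs_right (d a b)) by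
        (try (apply Rle_ge; left; apply Rinv_0_lt_compat); lra).
      apply Rle_div_l; [lra|].
      apply Rmult_le_reg_l with s; [lra|]. field_simplify; lra.
    - intros b Hb. apply Hb. exists x, y; split; auto. rewrite Hxy, Rabs_R1; auto. }
  unfold grad in Hr. rewrite (dist_sym q Hsym Hconn y x) in Hr.
  assert (Hr' : 0 <= lap q N h y - lap q N h x).
  { apply (Rmult_le_compat_r (d x y)) in Hr; [|lra].
    unfold Rdiv in Hr. rewrite Rmult_assoc, Rinv_l in Hr by lra. lra. }
  unfold h in Hr'. rewrite !lap_scal, <- Rmult_minus_distr_l in Hr'.
  apply (Rmult_le_compat_l s) in Hr'; [|lra].
  rewrite <- Rmult_assoc, Rinv_r in Hr' by lra. lra.
Qed.

(** Laplacian comparison: the distance from [o] is 1-Lipschitz and tight on [(x, o)], so curvature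
    bounds its Laplacian by the value at [o], whatever the degree of [x]. *)
Lemma lap_dist_le o x :
  lap q N (fun z => d o z) x <= lap q N (fun z => d o z) o.
Proof.
  destruct (classic (x = o)) as [->|Hne]; [lra|].
  apply curvature_lap_le with 1; [lra|auto| |].
  - intros a b. assert (H := dist_triangle_R o b a).
    rewrite (dist_sym q Hsym Hconn b a) in H. lra.
  - rewrite (dist_refl q Hconn), (dist_sym q Hsym Hconn x o). simpl; ring.
Qed.

Lemma lap_dist_nonneg o : 0 <= lap q N (fun z => d o z) o.
Proof.
  rewrite <- (lap_const 0 o). apply lap_le. intros y _.
  rewrite (dist_refl q Hconn). simpl. assert (H := pos_INR (dist q o y)). lra.
Qed.

(* The discrete counterpart of the second-order term in a two-point maximum
   principle: curvature is applied to the [s]-Lipschitz function squeezed between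
   [v] and [w], and each end of a geodesic contributes one edge along which
   [v] resp. [w] has the larger slope [s']. *)
Lemma two_point_lap_le (qm : R) v w x y s s' :
  (forall a b, q a b > 0 -> qm <= q a b) ->
  x <> y -> 0 <= s <= s' ->
  (forall a b, v a - w b <= v x - w y + s * (d a b - d x y)) ->
  (forall a b, (dist q a b + 1 <= dist q x y)%nat -> v a - w b <= v x - w y - s') ->
  lap q N v x - lap q N w y <= - 2 * qm * (s' - s).
Proof.
  intros Hqm Hne Hs H1 H2.
  set (c := v x - w y - s * d x y).
  set (F := fun z b => w b + s * d z b).
  (* An inf-convolution of [w] with [s] times the distance. The minimum runs only over [y] and its
     neighbours, the points seen by the Laplacian at [y], so it is over a finite list. *)
  set (g := fun z => lmin (F z) y (N y)).
  assert (Hvg : forall a, v a <= g a + c).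
  { intros a. assert (v a - c <= g a); [|lra]. apply lmin_ge. intros b _.
    unfold c, F. specialize (H1 a b). lra. }
  assert (Hgw : forall b, In b (y :: N y) -> g b <= w b).
  { intros b Hb. eapply Rle_trans; [apply (lmin_le _ _ _ b Hb)|].
    unfold F. rewrite (dist_refl q Hconn). simpl; lra. }
  assert (Hlip : forall a b, g a - g b <= s * d a b).
  { intros a b. assert (g a - s * d a b <= g b); [|lra]. apply lmin_ge. intros z Hz.
    assert (H := lmin_le (F a) y (N y) z Hz). fold (g a) in H. unfold F in *.
    assert (Ht := dist_triangle_R a b z).
    assert (s * d a z <= s * d a b + s * d b z); [|lra].
    rewrite <- Rmult_plus_distr_l. apply Rmult_le_compat_l; lra. }
  assert (Hgy : g y <= w y) by (apply Hgw; simpl; auto).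
  assert (Hvx := Hvg x). assert (Hxy := Hlip x y).
  (* The bounds [v <= g + c] at [x] and [g <= w] at [y] differ by exactly [s * d x y], so the
     Lipschitz bound forces equality in both. *)
  assert (Hgx : g x = w y + s * d x y) by (unfold c in *; lra).
  assert (Hgy' : g y = w y) by lra.
  destruct (geodesic_last_step q Hsym Hconn x y Hne) as [y1 [Hy1 Hdy]].
  destruct (geodesic_last_step q Hsym Hconn y x) as [x1 [Hx1 Hdx]]; [auto|].
  rewrite (dist_sym q Hsym Hconn y x1), (dist_sym q Hsym Hconn y x) in Hdx.
  (* Towards [y], along the edge from [x] to [x1], [v] drops by at least [s'] and [g] by at most
     [s]; [A2] is the mirror image at [y]. *)
  assert (A1 : lap q N v x + q x x1 * (s' - s) <= lap q N g x).
  { apply lap_le_gap; [|auto|].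
    - intros z _. specialize (Hvg z). unfold c in *. lra.
    - specialize (H2 x1 y Hdx). specialize (Hlip x x1).
      assert (s * d x x1 <= s * 1).
      { apply Rmult_le_compat_l; [lra|]. apply (le_INR _ 1), dist_edge; auto. }
      lra. }
  assert (A2 : lap q N g y + q y y1 * (s' - s) <= lap q N w y).
  { apply lap_le_gap; [|auto|].
    - intros z Hz. assert (g z <= w z) by (apply Hgw; right; apply HN; auto). lra.
    - specialize (H2 x y1 Hdy). specialize (Hlip y1 y).
      rewrite (dist_sym q Hsym Hconn y1 y) in Hlip.
      assert (s * d y y1 <= s * 1).
      { apply Rmult_le_compat_l; [lra|]. apply (le_INR _ 1), dist_edge; auto. }
      lra. }
  assert (A3 : lap q N g x <= lap q N g y).
  { apply curvature_lap_le with s; auto; lra. }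
  assert (qm * (s' - s) <= q x x1 * (s' - s)) by (apply Rmult_le_compat_r; [lra|auto]).
  assert (qm * (s' - s) <= q y y1 * (s' - s)) by (apply Rmult_le_compat_r; [lra|auto]).
  lra.
Qed.

End Curvature.

(** * The heat semigroup on a finite set *)

(** For each real [r] the terms are dominated by a multiple of [(C * r) ^ n / n!], a null and hence
    bounded sequence, so the radius is at least every [r]. *)
Lemma CV_radius_exp_type (a : nat -> R) (K C : R) :
  (forall k, Rabs (a k) <= K * C ^ k) ->
  CV_radius (fun k => a k / INR (fact k)) = p_infty.
Proof.
  intros Ha.
  assert (Hub : forall r : R, Rbar_le r (CV_radius (fun k => a k / INR (fact k)))).
  { intros r. apply (CV_radius_bounded (fun k => a k / INR (fact k))).
    destruct (maj_by_pos (fun n => (C * r) ^ n / INR (fact n))) as [M [HM HMn]].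
    { exists 0. apply cv_speed_pow_fact. }
    exists (Rabs K * M). intros n.
    assert (Hf := INR_fact_lt_0 n).
    replace (a n / INR (fact n) * r ^ n) with (a n * (r ^ n / INR (fact n))) by (field; lra).
    rewrite Rabs_mult.
    apply Rle_trans with (Rabs (K * C ^ n) * Rabs (r ^ n / INR (fact n))).
    - apply Rmult_le_compat_r; [apply Rabs_pos|].
      eapply Rle_trans; [apply Ha|apply Rle_abs].
    - rewrite Rabs_mult, Rmult_assoc, <- Rabs_mult.
      apply Rmult_le_compat_l; [apply Rabs_pos|].
      replace (C ^ n * (r ^ n / INR (fact n))) with ((C * r) ^ n / INR (fact n))
        by (rewrite Rpow_mult_distr; field; lra).
      apply HMn. }
  destruct (CV_radius _) as [r| |]; [|auto|].
  - specialize (Hub (r + 1)). simpl in Hub. lra.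
  - destruct (Hub 0).
Qed.

Lemma is_pseries_lsum {A : Type} (l : list A) (F : A -> nat -> R) (G : A -> R) (t : R) :
  (forall y, In y l -> is_pseries (F y) t (G y)) ->
  is_pseries (fun k => lsum (fun y => F y k) l) t (lsum G l).
Proof.
  unfold lsum; induction l as [|b l IH]; intros H; simpl.
  (* The zero series is obtained as [0] times the exponential series. *)
  - apply is_pseries_ext with (PS_scal 0 (fun k => / INR (fact k))).
    + intros n. unfold PS_scal, scal; simpl; unfold mult; simpl. ring.
    + assert (E := is_pseries_scal (0 : R_AbsRing) (fun k => / INR (fact k)) t (exp t)
        (Rmult_comm _ _) (is_exp_Reals t)).
      change (scal (0 : R_AbsRing) (exp t)) with (0 * exp t) in E.
      rewrite Rmult_0_l in E. exact E.
  - apply (is_pseries_plus (F b)); [apply H; simpl; auto|]. apply IH; intros; apply H; simpl; auto.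
Qed.

Section Heat.
Context {V : Type} (q : V -> V -> R) (N : V -> list V).
Context (Hq : forall x y, 0 <= q x y) (HN : neighbour_list q N).

Lemma lap_abs_le g M x :
  (forall y, Rabs (g y) <= M) -> Rabs (lap q N g x) <= 2 * lsum (q x) (N x) * M.
Proof.
  intros Hg.
  assert (E : lsum (fun y => 0 + 2 * M * q x y) (N x) = 2 * lsum (q x) (N x) * M).
  { rewrite lsum_lin, lsum_const. ring. }
  assert (E' : lsum (fun y => 0 + (- (2 * M)) * q x y) (N x) = - (2 * lsum (q x) (N x) * M)).
  { rewrite lsum_lin, lsum_const. ring. }
  rewrite lap_lsum. apply Rabs_le; rewrite <- E', <- E; split;
    apply lsum_le; intros y _; specialize (Hq x y);
    destruct (Rabs_le_between (g x) M) as [A _]; destruct (Rabs_le_between (g y) M) as [B _];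
    specialize (A (Hg x)); specialize (B (Hg y)); nra.
Qed.

Context (S : V -> bool) (HS : finite_set S) (f : V -> R) (K : R).
Context (Hf : forall x, Rabs (f x) <= K).

Notation iterates k x := (Nat.iter k (lapS q N S) (ind S f) x).

Lemma degree_bounded_on_finite :
  exists C, 0 <= C /\ forall x, S x = true -> 2 * lsum (q x) (N x) <= C.
Proof.
  destruct HS as [l Hl].
  assert (H : exists C, 0 <= C /\ forall x, In x l -> 2 * lsum (q x) (N x) <= C).
  { clear Hl. induction l as [|b l [C [HC IH]]].
    - exists 0; split; [lra|]. intros x [].
    - exists (Rmax C (2 * lsum (q b) (N b))); split; [eapply Rle_trans; [apply HC|apply Rmax_l]|].
      intros x [->|Hx]; [apply Rmax_r|]. eapply Rle_trans; [apply IH, Hx|apply Rmax_l]. }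
  destruct H as [C [HC H]]. exists C; auto.
Qed.

(** On a finite [S] the weighted degrees are bounded, so [lapS] is a bounded operator for the sup
    norm and each application costs a factor [C]. *)
Lemma iterates_bound : exists C, forall k x, Rabs (iterates k x) <= K * C ^ k.
Proof.
  destruct degree_bounded_on_finite as [C [HC H]]. exists C.
  induction k as [|k IH]; intros x; simpl.
  - specialize (Hf x). unfold ind. destruct (S x); [lra|].
    rewrite Rabs_R0. assert (A := Rabs_pos (f x)). lra.
  - assert (HK : 0 <= K * C ^ k) by (eapply Rle_trans; [apply Rabs_pos|apply (IH x)]).
    unfold lapS at 1. destruct (S x) eqn:E.
    + eapply Rle_trans; [apply lap_abs_le, IH|].
      apply Rle_trans with (C * (K * C ^ k)); [|lra].
      apply Rmult_le_compat_r; auto.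
    + rewrite Rabs_R0. apply (Rmult_le_compat_l C) in HK; lra.
Qed.

Lemma heat_radius x : CV_radius (fun k => iterates k x / INR (fact k)) = p_infty.
Proof.
  destruct iterates_bound as [C HC].
  apply CV_radius_exp_type with K C. intros k; apply HC.
Qed.

(** [heatS] picks a sum by [epsilon]; since the exponential series converges for every [t], the
    choice is its actual sum. *)
Lemma heat_pseries x t :
  is_pseries (fun k => iterates k x / INR (fact k)) t (heatS q N S t f x).
Proof.
  set (c := fun k => iterates k x / INR (fact k)).
  assert (Hc : is_pseries c t (PSeries c t)).
  { apply PSeries_correct, CV_radius_inside. unfold c. rewrite heat_radius. exact I. }
  assert (Hterm : forall k, scal (pow_n t k) (c k) = heat_term q N S t f x k).
  { intros k. unfold heat_term, c. rewrite pow_n_pow. unfold scal; simpl; unfold mult; simpl.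
    field. apply INR_fact_neq_0. }
  assert (Hsum : exists l, infinite_sum (heat_term q N S t f x) l).
  { exists (PSeries c t). apply is_series_Reals.
    eapply is_series_ext; [|apply Hc]. exact Hterm. }
  assert (H : infinite_sum (heat_term q N S t f x) (heatS q N S t f x)).
  { unfold heatS. apply epsilon_spec, Hsum. }
  apply is_series_Reals in H. unfold is_pseries.
  eapply is_series_ext; [|apply H]. intros k; symmetry; apply Hterm.
Qed.

Lemma heat_PSeries x t :
  heatS q N S t f x = PSeries (fun k => iterates k x / INR (fact k)) t.
Proof. symmetry; apply is_pseries_unique, heat_pseries. Qed.

Lemma heat_0 x : heatS q N S 0 f x = ind S f x.
Proof. rewrite heat_PSeries, PSeries_0. simpl. field. Qed.

Lemma heat_outside x t : S x = false -> heatS q N S t f x = 0.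
Proof.
  intros E. rewrite heat_PSeries.
  rewrite (PSeries_ext _ (PS_scal 0 (fun _ => 0))).
  - rewrite PSeries_scal; ring.
  - intros k. unfold PS_scal, scal; simpl; unfold mult; simpl.
    replace (iterates k x) with 0; [unfold Rdiv; ring|].
    destruct k; simpl; [unfold ind|unfold lapS]; rewrite E; auto.
Qed.

(** Termwise differentiation shifts the index by one, and on [S] the extra [lapS] is the full [lap],
    which commutes with the series as a finite sum. *)
Lemma heat_equation x t :
  S x = true ->
  derivable_pt_lim (fun s => heatS q N S s f x) t (lap q N (heatS q N S t f) x).
Proof.
  intros E. apply is_derive_Reals.
  apply is_derive_ext with (PSeries (fun k => iterates k x / INR (fact k))).
  { intros s; symmetry; apply heat_PSeries. }
  replace (lap q N (heatS q N S t f) x)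
    with (PSeries (PS_derive (fun k => iterates k x / INR (fact k))) t).
  { apply is_derive_PSeries. rewrite heat_radius. exact I. }
  apply is_pseries_unique. rewrite lap_lsum.
  apply is_pseries_ext with
    (fun k => lsum (fun y => q x y * (iterates k y / INR (fact k) - iterates k x / INR (fact k))) (N x)).
  - intros k. unfold PS_derive.
    replace (INR (Datatypes.S k) * (iterates (Datatypes.S k) x / INR (fact (Datatypes.S k))))
      with (/ INR (fact k) * lap q N (Nat.iter k (lapS q N S) (ind S f)) x).
    + rewrite <- lap_scal, lap_lsum. apply lsum_ext; intros; unfold Rdiv; ring.
    + assert (E2 : iterates (Datatypes.S k) x = lap q N (Nat.iter k (lapS q N S) (ind S f)) x).
      { simpl. unfold lapS at 1. rewrite E. reflexivity. }
      rewrite E2, fact_simpl, mult_INR. field.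
      split; [apply INR_fact_neq_0|apply not_0_INR; lia].
  - apply is_pseries_lsum. intros y _.
    assert (Hy := heat_pseries y t). assert (Hx := heat_pseries x t).
    apply (is_pseries_scal (q x y) (PS_minus (fun k => iterates k y / INR (fact k))
       (fun k => iterates k x / INR (fact k))) t (plus (heatS q N S t f y) (opp (heatS q N S t f x)))).
    + apply Rmult_comm.
    + apply (is_pseries_minus _ _ t _ _ Hy Hx).
Qed.

End Heat.

(** * Sup-norm bound for the Dirichlet heat flow *)

Section HeatBound.
Context {V : Type} (q : V -> V -> R) (N : V -> list V).
Context (Hq : forall x y, 0 <= q x y) (HN : neighbour_list q N).

Lemma dirichlet_heat_le (S : V -> bool) (u : R -> V -> R) (K T : R) :
  finite_set S -> 0 <= K ->
  (forall x t, S x = true -> derivable_pt_lim (fun s => u s x) t (lap q N (u t) x)) ->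
  (forall x t, S x = false -> u t x = 0) ->
  (forall x, u 0 x <= K) ->
  0 <= T -> forall x, u T x <= K.
Proof.
  intros [l Hl] HK Hd Hout H0 HT x.
  destruct (S x) eqn:Ex; [|rewrite Hout; auto].
  apply le_epsilon; intros e He.
  (* The slope [de] makes the derivative at a maximum strictly negative; dividing by [T + 1] keeps
     [de * T <= e] and allows [T = 0]. *)
  set (de := e / (T + 1)).
  assert (Hde : 0 < de) by (apply Rdiv_lt_0_compat; lra).
  assert (HdT : de * T <= e).
  { replace e with (de * (T + 1)) by (unfold de; field; lra). nra. }
  assert (H : u T x - K - de * T <= 0); [|lra].
  apply (finite_max_principle (filter S l) (fun x t => u t x - K - de * t)
          (fun x t => lap q N (u t) x - 0 - de * 1) T).
  - intros y t Hy _. apply filter_In in Hy.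
    apply derivable_pt_lim_minus; [apply derivable_pt_lim_minus|].
    + apply Hd, Hy.
    + apply derivable_pt_lim_const.
    + apply derivable_pt_lim_scal, derivable_pt_lim_id.
  - intros y _. specialize (H0 y). lra.
  - intros y t Hy Ht Hpos Hmax.
    assert (lap q N (u t) y <= 0); [|lra].
    rewrite <- (lap_const q N 0 y). apply lap_le; auto. intros z _.
    assert (u t z <= u t y); [|lra].
    destruct (S z) eqn:Ez.
    + assert (u t z - K - de * t <= u t y - K - de * t); [|lra].
      apply Hmax, filter_In; auto.
    (* A neighbour outside [S] carries the boundary value [0], which lies below [u t y] since that
       exceeds [K >= 0]. *)
    + rewrite (Hout z t Ez). nra.
  - apply filter_In; auto.
  - lra.
Qed.

Lemma heat_abs_le (S : V -> bool) (f : V -> R) (K t : R) x :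
  finite_set S -> (forall y, Rabs (f y) <= K) -> 0 <= t ->
  Rabs (heatS q N S t f x) <= K.
Proof.
  intros HS Hf Ht.
  assert (HK : 0 <= K) by (eapply Rle_trans; [apply Rabs_pos|apply (Hf x)]).
  assert (H0 : forall y, - K <= ind S f y <= K).
  { intros y. apply Rabs_le_between. unfold ind. destruct (S y); [auto|rewrite Rabs_R0; auto]. }
  assert (H1 : heatS q N S t f x <= K).
  { apply (dirichlet_heat_le S (fun t => heatS q N S t f)); auto.
    - intros; eapply heat_equation; eauto.
    - intros; eapply heat_outside; eauto.
    - intros y. erewrite heat_0; eauto. apply H0. }
  assert (H2 : -1 * heatS q N S t f x <= K).
  { apply (dirichlet_heat_le S (fun t y => -1 * heatS q N S t f y)); auto.
    - intros y s Hy. rewrite lap_scal.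
      apply (derivable_pt_lim_scal (fun s => heatS q N S s f y)).
      eapply heat_equation; eauto.
    - intros y s Hy. erewrite heat_outside; eauto. ring.
    - intros y. erewrite heat_0; eauto. specialize (H0 y). lra. }
  apply Rabs_le; lra.
Qed.

End HeatBound.

(** * The modulus of continuity *)

Section ConcaveSequence.
Context (a : nat -> R).
Context (Hconc : forall k, a (S (S k)) - a (S k) <= a (S k) - a k).

Lemma concave_slope_antitone k j : a (S (k + j)) - a (k + j)%nat <= a (S k) - a k.
Proof.
  induction j as [|j IH]; [rewrite Nat.add_0_r; lra|].
  rewrite Nat.add_succ_r. specialize (Hconc (k + j)). lra.
Qed.

(** The line has the forward slope at [n]: later slopes are smaller and earlier ones larger, so it
    stays above the sequence on both sides. It turns maximality of a pair into the Lipschitz-type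
    hypothesis of [two_point_lap_le]. *)
Lemma concave_tangent n j : a j <= a n + (a (S n) - a n) * (INR j - INR n).
Proof.
  destruct (Nat.le_ge_cases n j) as [H|H].
  - replace j with (n + (j - n))%nat by lia. generalize (j - n)%nat as k. clear j H.
    induction k as [|k IH]; [rewrite Nat.add_0_r; lra|].
    rewrite Nat.add_succ_r, S_INR. assert (A := concave_slope_antitone n k). nra.
  - assert (G : forall k i, n = (i + k)%nat ->
              a i <= a n + (a (S n) - a n) * (INR i - INR n)).
    { induction k as [|k IH]; intros i ->.
      - rewrite Nat.add_0_r; lra.
      - assert (B := IH (S i) ltac:(lia)). rewrite S_INR in B.
        assert (A := concave_slope_antitone i (S k)). nra. }
    apply (G (n - j)%nat); lia.
Qed.

End ConcaveSequence.

Lemma nondecreasing_le (a : nat -> R) :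
  (forall k, a k <= a (S k)) -> forall i j, (i <= j)%nat -> a i <= a j.
Proof.
  intros H i j Hij; induction Hij as [|j _ IH]; [lra|]. specialize (H j); lra.
Qed.

Definition pos (x : R) : R := Rmax 0 x.

Ltac pos_cases := unfold pos, Rmax in *; repeat destruct (Rle_dec _ _).

(** Squaring removes the kink of [pos], with error at most [h ^ 2]; hence [profile] stays
    differentiable in time when the moving scale passes [n]. *)
Lemma derivable_pos_sqr x : derivable_pt_lim (fun y => pos y ^ 2) x (2 * pos x).
Proof.
  intros e He. exists (mkposreal e He). intros h Hh Hhe; simpl in Hhe.
  assert (E : Rabs (pos (x + h) ^ 2 - pos x ^ 2 - 2 * pos x * h) <= Rabs h * Rabs h).
  { rewrite <- Rabs_mult, (Rabs_right (h * h)) by nra.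
    apply Rabs_le; pos_cases; split; nra. }
  assert (0 < Rabs h) by (apply Rabs_pos_lt; auto).
  replace ((pos (x + h) ^ 2 - pos x ^ 2) / h - 2 * pos x)
    with ((pos (x + h) ^ 2 - pos x ^ 2 - 2 * pos x * h) / h) by (field; auto).
  rewrite Rabs_div by auto.
  apply Rle_lt_trans with (Rabs h); [|auto].
  apply Rle_div_l; auto.
Qed.

Lemma pos_sqr_convex x h : 2 * pos x ^ 2 <= pos (x - h) ^ 2 + pos (x + h) ^ 2.
Proof. pos_cases; nra. Qed.

(* [profile K m] rises along a parabola from [0] at [n = 0] to its maximum [2 K]
   at [n = m] and stays there. *)
Definition profile (K m : R) (n : nat) : R := 2 * K - 2 * K * pos (1 - INR n / m) ^ 2.

Section Profile.
Context (K m : R) (HK : 0 <= K) (Hm : 1 <= m).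

Lemma profile_0 : profile K m 0 = 0.
Proof. unfold profile. simpl INR. replace (1 - 0 / m) with 1 by (field; lra).
  unfold pos. rewrite Rmax_right by lra. ring.
Qed.

Lemma profile_monotone k : profile K m k <= profile K m (S k).
Proof.
  unfold profile.
  assert (H : pos (1 - INR (S k) / m) ^ 2 <= pos (1 - INR k / m) ^ 2); [|nra].
  assert (H' : INR k / m <= INR (S k) / m).
  { apply Rmult_le_compat_r; [left; apply Rinv_0_lt_compat; lra|]. rewrite S_INR; lra. }
  pos_cases; nra.
Qed.

Lemma profile_concave k :
  profile K m (S (S k)) - profile K m (S k) <= profile K m (S k) - profile K m k.
Proof.
  unfold profile.
  assert (H := pos_sqr_convex (1 - INR (S k) / m) (1 / m)).
  replace (1 - INR (S k) / m - 1 / m) with (1 - INR (S (S k)) / m) in H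
    by (rewrite !S_INR; field; lra).
  replace (1 - INR (S k) / m + 1 / m) with (1 - INR k / m) in H
    by (rewrite !S_INR; field; lra).
  nra.
Qed.

Lemma pos_scaled x : pos (1 - x / m) = pos (m - x) / m.
Proof.
  assert (E : 1 - x / m = (m - x) / m) by (field; lra). rewrite E.
  assert (0 < / m) by (apply Rinv_0_lt_compat; lra).
  unfold Rdiv. pos_cases; nra.
Qed.

(** The supersolution inequality for [profile] with denominators cleared. The cases follow whether
    [n] lies beyond the vertex [m] of the parabola, at least one step before it, or within its last
    step. *)
Lemma pos_second_difference n :
  1 <= n ->
  16 * pos (m - n) * n <=
  m * (2 * m + 1) * (pos (m - (n + 1)) ^ 2 - 2 * pos (m - n) ^ 2 + pos (m - (n - 1)) ^ 2).
Proof.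
  intros Hn. set (r := m - n).
  replace (m - (n + 1)) with (r - 1) by (unfold r; ring).
  replace (m - (n - 1)) with (r + 1) by (unfold r; ring).
  destruct (Rle_dec r 0) as [H0|H0]; [|destruct (Rle_dec 1 r) as [H1|H1]].
  - assert (A := pos_sqr_convex r 1).
    replace (pos r) with 0 in * by (unfold pos; rewrite Rmax_left; lra).
    rewrite Rmult_0_r, Rmult_0_l. apply Rmult_le_pos; nra.
  - replace (pos r) with r by (unfold pos; rewrite Rmax_right; lra).
    replace (pos (r - 1)) with (r - 1) by (unfold pos; rewrite Rmax_right; lra).
    replace (pos (r + 1)) with (r + 1) by (unfold pos; rewrite Rmax_right; lra).
    replace m with (n + r) by (unfold r; ring). clearbody r. clear Hm.
    assert (0 <= (n - r) ^ 2) by apply pow2_ge_0. nra.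
  - replace (pos r) with r by (unfold pos; rewrite Rmax_right; lra).
    replace (pos (r - 1)) with 0 by (unfold pos; rewrite Rmax_left; lra).
    replace (pos (r + 1)) with (r + 1) by (unfold pos; rewrite Rmax_right; lra).
    replace m with (n + r) by (unfold r; ring). clearbody r. clear Hm.
    (* In the last step the second difference is [1 + 2 * r - r ^ 2]. With [A] as lower bound for
       the prefactor, what remains is [n] times the cubic in [B], equal to [(1 - 3 * r) ^ 2 + 2 * r
       ^ 2 * (3 - 4 * r)]. *)
    assert (A : 8 * n * r + n <= (n + r) * (2 * (n + r) + 1)).
    { assert (0 <= (n - r) ^ 2) by apply pow2_ge_0. nra. }
    assert (B : 0 <= 1 - 6 * r + 15 * r ^ 2 - 8 * r ^ 3).
    { destruct (Rle_dec r (3 / 4)).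
      - assert (0 <= (1 - 3 * r) ^ 2) by apply pow2_ge_0. nra.
      - nra. }
    assert (C : (8 * n * r + n) * (1 + 2 * r - r ^ 2) <=
                (n + r) * (2 * (n + r) + 1) * (1 + 2 * r - r ^ 2)).
    { apply Rmult_le_compat_r; nra. }
    assert (D : 0 <= n * (1 - 6 * r + 15 * r ^ 2 - 8 * r ^ 3)) by (apply Rmult_le_pos; lra).
    nra.
Qed.

(** Here [s] stands for [sqrt (t * qm)]. Before the vertex, [n >= 1] bounds the parabola's chord
    slope [(4 * m - 2 * n) / m ^ 2] by [(4 * m - 2) / m ^ 2], leaving [Hs4], whose leading terms
    agree; beyond it [2 * s <= m] suffices. *)
Lemma profile_le_linear s n :
  0 < s -> 16 * s ^ 2 = (m - 1) * (m + 2) -> 1 <= INR n ->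
  profile K m n <= K * (INR n / s).
Proof.
  intros Hs E Hn. unfold profile. rewrite pos_scaled. set (r := INR n) in *.
  assert (H : 2 - 2 * (pos (m - r) / m) ^ 2 <= r / s).
  2:{ assert (K * (2 - 2 * (pos (m - r) / m) ^ 2) <= K * (r / s))
        by (apply Rmult_le_compat_l; auto). lra. }
  assert (Hs2 : 2 * s <= m) by nra.
  assert (Hs4 : (4 * m - 2) * s <= m ^ 2).
  { apply Rsqr_incr_0_var; [|nra]. unfold Rsqr.
    replace ((4 * m - 2) * s * ((4 * m - 2) * s))
      with ((4 * m - 2) ^ 2 * (16 * s ^ 2) / 16) by field.
    rewrite E. nra. }
  apply Rle_div_r; [auto|].
  unfold pos, Rmax. destruct (Rle_dec 0 (m - r)) as [H|H].
  - replace ((2 - 2 * ((m - r) / m) ^ 2) * s)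
      with (r * ((4 * m - 2 * r) * s) / m ^ 2) by (field; lra).
    apply Rle_div_l; [nra|]. apply Rmult_le_compat_l; nra.
  - replace ((2 - 2 * (0 / m) ^ 2) * s) with (2 * s) by (field; lra). lra.
Qed.

End Profile.

(* The solution of [(m - 1) (m + 2) = 16 qm t], chosen so that [profile K (scale qm t)]
   is a supersolution of the heat equation with jump rate [2 qm] which at [t = 0]
   equals [2 K] off the origin. *)
Definition scale (qm t : R) : R := (sqrt (9 + 64 * qm * t) - 1) / 2.

Section Scale.
Context (qm t : R) (Hqm : 0 < qm) (Ht : 0 <= t).

Lemma scale_eq : (scale qm t - 1) * (scale qm t + 2) = 16 * (qm * t).
Proof.
  unfold scale. assert (0 <= qm * t) by nra.
  assert (E := sqrt_sqrt (9 + 64 * qm * t) ltac:(nra)). nra.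
Qed.

Lemma scale_ge_1 : 1 <= scale qm t.
Proof.
  unfold scale. assert (3 <= sqrt (9 + 64 * qm * t)); [|lra].
  rewrite <- (sqrt_square 3) by lra. apply sqrt_le_1_alt. nra.
Qed.

(** Implicit differentiation of [(m - 1) * (m + 2) = 16 * qm * t]. *)
Lemma derivable_scale :
  derivable_pt_lim (scale qm) t (16 * qm / (2 * scale qm t + 1)).
Proof.
  assert (0 <= qm * t) by nra.
  assert (Hs : 0 < sqrt (9 + 64 * qm * t)) by (apply sqrt_lt_R0; nra).
  apply is_derive_Reals. unfold scale. auto_derive; [nra|]. field; lra.
Qed.

Lemma derivable_profile K n :
  derivable_pt_lim (fun s => profile K (scale qm s) n) t
    (- (2 * K * (2 * pos (1 - INR n / scale qm t)) *
        (INR n / scale qm t ^ 2 * (16 * qm / (2 * scale qm t + 1))))).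
Proof.
  assert (Hm := scale_ge_1).
  assert (D1 : derivable_pt_lim (fun s => 1 - INR n / scale qm s) t
     (INR n / scale qm t ^ 2 * (16 * qm / (2 * scale qm t + 1)))).
  { assert (D := derivable_scale). apply is_derive_Reals. apply is_derive_Reals in D.
    auto_derive.
    - split; [eexists; apply D|split; [lra|auto]].
    - replace (Derive (fun s => scale qm s) t) with (16 * qm / (2 * scale qm t + 1))
        by (symmetry; apply is_derive_unique, D).
      field; lra. }
  assert (D2 := derivable_pt_lim_comp _ _ _ _ _ D1
     (derivable_pos_sqr (1 - INR n / scale qm t))).
  assert (D3 := derivable_pt_lim_scal _ (2 * K) _ _ D2).
  assert (D4 := derivable_pt_lim_minus _ _ _ _ _ (derivable_pt_lim_const (2 * K) t) D3).
  match goal with |- derivable_pt_lim _ _ ?l =>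
    match type of D4 with derivable_pt_lim _ _ ?l' => replace l with l' by ring end end.
  exact D4.
Qed.

Lemma profile_supersolution K k :
  0 <= K ->
  2 * qm * (profile K (scale qm t) (S (S k)) - 2 * profile K (scale qm t) (S k)
            + profile K (scale qm t) k) <=
  - (2 * K * (2 * pos (1 - INR (S k) / scale qm t)) *
      (INR (S k) / scale qm t ^ 2 * (16 * qm / (2 * scale qm t + 1)))).
Proof.
  intros HK. assert (Hm := scale_ge_1). set (m := scale qm t) in *. clearbody m.
  unfold profile. rewrite !(pos_scaled m Hm).
  set (n := INR (S k)).
  assert (Hn : 1 <= n) by (apply (le_INR 1); lia).
  replace (INR (S (S k))) with (n + 1) by (unfold n; now rewrite <- S_INR).
  replace (INR k) with (n - 1) by (unfold n; rewrite S_INR; ring).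
  assert (H := pos_second_difference m Hm n Hn).
  set (P0 := pos (m - n)) in *. set (P1 := pos (m - (n + 1))) in *.
  set (P2 := pos (m - (n - 1))) in *.
  (* The factor relating [pos_second_difference] to the differential inequality. *)
  assert (Hc : 0 <= 4 * qm * K / (m ^ 3 * (2 * m + 1))).
  { apply Rmult_le_pos; [nra|]. left; apply Rinv_0_lt_compat.
    apply Rmult_lt_0_compat; [apply pow_lt|]; lra. }
  apply (Rmult_le_compat_l _ _ _ Hc) in H.
  apply Ropp_le_contravar in H.
  eapply Rle_trans; [eapply Rle_trans; [|apply H]|]; right; field; lra.
Qed.

End Scale.

(** * Comparison *)

Section Comparison.
Context {V : Type} (q : V -> V -> R) (N : V -> list V).
Context (Hq : forall x y, 0 <= q x y) (HN : neighbour_list q N).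
Context (Hsym : forall x y, q x y > 0 -> q y x > 0).
Context (Hconn : connected q) (Hcurv : nonneg_ollivier q N).
Context (qm : R) (Hqm0 : 0 < qm) (Hqm : forall x y, q x y > 0 -> qm <= q x y).

Notation d x y := (INR (dist q x y)).

(* The penalty [eps (d o x + d o y)] confines the maximum over pairs to the finite
   set [L], where [u] solves the heat equation; curvature bounds its Laplacian by
   [D] per variable. *)
Lemma heat_modulus (u : R -> V -> R) (L : list V) (o : V) (K eps D : R) :
  0 <= K -> 0 < eps -> D = lap q N (fun z => d o z) o ->
  (forall x, eps * d o x <= 2 * K -> In x L) ->
  (forall x t, In x L -> derivable_pt_lim (fun s => u s x) t (lap q N (u t) x)) ->
  (forall x t, 0 <= t -> Rabs (u t x) <= K) ->
  forall T x y, 0 <= T ->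
    u T x - u T y <=
    profile K (scale qm T) (dist q x y) + eps * (d o x + d o y + (2 * D + 1) * T).
Proof.
  intros HK Heps HD HL Heq Hbd T x y HT.
  assert (HD0 : 0 <= D) by (subst D; apply lap_dist_nonneg; auto).
  (* In the drift [eps * (2 * D + 1)], the part [2 * D] absorbs the Laplacians of the two penalties
     and the remaining [eps] gives strictness. *)
  set (F := fun (p : V * V) t => u t (fst p) - u t (snd p)
      - profile K (scale qm t) (dist q (fst p) (snd p))
      - eps * (d o (fst p) + d o (snd p)) - eps * (2 * D + 1) * t).
  assert (Hprof : forall t n, 0 <= t -> 0 <= profile K (scale qm t) n).
  { intros t n Ht. rewrite <- (profile_0 K (scale qm t) (scale_ge_1 qm t Hqm0 Ht)).
    apply nondecreasing_le; [|lia]. intros; apply profile_monotone; auto using scale_ge_1. }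
  assert (Hdiff : forall t a b, 0 <= t -> u t a - u t b <= 2 * K).
  { intros t a b Ht. assert (A := Hbd a t Ht). assert (B := Hbd b t Ht).
    apply Rabs_le_between in A. apply Rabs_le_between in B. lra. }
  assert (Hd0 : forall a, 0 <= eps * d o a).
  { intros a. apply Rmult_le_pos; [lra|apply pos_INR]. }
  assert (Hlin : forall t, 0 <= t -> 0 <= eps * (2 * D + 1) * t).
  { intros t Ht. apply Rmult_le_pos; nra. }
  assert (Hout : forall t p, 0 <= t -> ~ In p (list_prod L L) -> F p t <= 0).
  { intros t [a b] Ht Hp. unfold F; cbn [fst snd].
    assert (A := Hdiff t a b Ht). assert (B := Hprof t (dist q a b) Ht).
    assert (Ha := Hd0 a). assert (Hb := Hd0 b). assert (C := Hlin t Ht).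
    assert (2 * K <= eps * (d o a + d o b)); [|lra].
    destruct (Rle_dec (eps * d o a) (2 * K)) as [Ia|Ia]; [|lra].
    destruct (Rle_dec (eps * d o b) (2 * K)) as [Ib|Ib]; [|lra].
    destruct Hp. apply in_prod; auto. }
  assert (Hgoal : F (x, y) T <= 0); [|unfold F in Hgoal; cbn [fst snd] in Hgoal; lra].
  destruct (classic (In (x, y) (list_prod L L))) as [Hin|]; [|apply Hout; auto].
  apply (finite_max_principle (list_prod L L) F
    (fun p t => lap q N (u t) (fst p) - lap q N (u t) (snd p)
      - (- (2 * K * (2 * pos (1 - INR (dist q (fst p) (snd p)) / scale qm t)) *
        (INR (dist q (fst p) (snd p)) / scale qm t ^ 2 * (16 * qm / (2 * scale qm t + 1)))))
      - 0 - eps * (2 * D + 1) * 1) T); [| | |auto|lra].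
  - intros [a b] t Hp Ht. apply in_prod_iff in Hp. unfold F; cbn [fst snd].
    apply derivable_pt_lim_minus; [apply derivable_pt_lim_minus;
      [apply derivable_pt_lim_minus; [apply derivable_pt_lim_minus|]|]|].
    + apply Heq; tauto.
    + apply Heq; tauto.
    + apply derivable_profile; lra.
    + apply derivable_pt_lim_const.
    + apply derivable_pt_lim_scal, derivable_pt_lim_id.
  - intros [a b] _. unfold F; cbn [fst snd].
    assert (Ha := Hd0 a). assert (Hb := Hd0 b).
    destruct (classic (a = b)) as [->|Hne].
    + assert (B := Hprof 0 (dist q b b) (Rle_refl 0)). lra.
    (* At time [0] the scale is [1], so the profile has reached its plateau [2 * K] at every
       distance at least [1]. *)
    + assert (B : 2 * K <= profile K (scale qm 0) (dist q a b)).
      { unfold profile, scale. rewrite Rmult_0_r, Rplus_0_r.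
        replace (sqrt 9) with 3 by (symmetry; rewrite <- (sqrt_square 3) by lra; f_equal; ring).
        assert (A := dist_pos_R q Hconn a b Hne).
        unfold pos. rewrite Rmax_left by lra. lra. }
      assert (C := Hdiff 0 a b (Rle_refl 0)). lra.
  - intros [a b] t Hp Ht Hpos Hmax. cbn [fst snd].
    assert (Ht0 : 0 <= t) by lra.
    assert (Hm := scale_ge_1 qm t Hqm0 Ht0).
    assert (Hne : a <> b).
    { intros ->. unfold F in Hpos; cbn [fst snd] in Hpos.
      assert (B := Hprof t (dist q b b) Ht0). assert (Ha := Hd0 b). assert (C := Hlin t Ht0).
      lra. }
    (* Outside [L] the penalty alone exceeds [2 * K], so the positive maximum is one over all pairs
       of vertices. *)
    assert (Hmax' : forall a' b', F (a', b') t <= F (a, b) t).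
    { intros a' b'. destruct (classic (In (a', b') (list_prod L L))) as [Hi|Hi]; [auto|].
      apply Rle_trans with 0; [auto|lra]. }
    set (m := scale qm t) in *.
    assert (Hk : exists k, dist q a b = S k).
    { assert (A := dist_pos q Hconn a b Hne). exists (pred (dist q a b)). lia. }
    destruct Hk as [k Hk].
    assert (Hsuper := profile_supersolution qm t Hqm0 Ht0 K k HK). fold m in Hsuper.
    assert (Hmono := profile_monotone K m HK Hm).
    assert (Hconc := profile_concave K m HK Hm).
    (* The penalties are absorbed into [v] and [w]; [s] and [s'] are the forward and backward slopes
       of the profile at [S k], so [s' - s] is minus its second difference. *)
    assert (Hkey : lap q N (fun z => u t z + - eps * d o z) a
                   - lap q N (fun z => u t z + eps * d o z) b <=
      - 2 * qm * ((profile K m (S k) - profile K m k)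
                  - (profile K m (S (S k)) - profile K m (S k)))).
    { apply two_point_lap_le; auto.
      - specialize (Hmono (S k)). specialize (Hconc k). lra.
      - intros a' b'. specialize (Hmax' a' b'). unfold F in Hmax'; cbn [fst snd] in Hmax'.
        assert (A := concave_tangent (profile K m) Hconc (S k) (dist q a' b')).
        fold m in Hmax'. rewrite Hk in *. lra.
      - intros a' b' Hlt. specialize (Hmax' a' b'). unfold F in Hmax'; cbn [fst snd] in Hmax'.
        assert (A := nondecreasing_le (profile K m) Hmono (dist q a' b') k ltac:(lia)).
        fold m in Hmax'. rewrite Hk in *. lra. }
    rewrite !lap_lin in Hkey.
    assert (Da := lap_dist_le q N Hq HN Hsym Hconn Hcurv o a).
    assert (Db := lap_dist_le q N Hq HN Hsym Hconn Hcurv o b).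
    rewrite <- HD in Da, Db.
    apply (Rmult_le_compat_l eps) in Da; [|lra].
    apply (Rmult_le_compat_l eps) in Db; [|lra].
    rewrite Hk. lra.
Qed.

End Comparison.

(** * Passage to the limit along an exhaustion *)

Lemma exhaustion_contains_list {V : Type} (Sq : nat -> V -> bool) (l : list V) :
  exhaustion Sq -> exists i0, forall i, (i0 <= i)%nat -> forall x, In x l -> Sq i x = true.
Proof.
  intros [_ [Hinc Hcov]].
  assert (Hmono : forall i j x, (i <= j)%nat -> Sq i x = true -> Sq j x = true).
  { intros i j x Hij H; induction Hij; auto. }
  induction l as [|b l [i1 H1]].
  - exists 0%nat. intros i _ x [].
  - destruct (Hcov b) as [i2 H2]. exists (max i1 i2). intros i Hi x [<-|Hx].
    + apply Hmono with i2; [lia|auto].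
    + apply H1; [lia|auto].
Qed.

Lemma Un_cv_le_eventually (a : nat -> R) (A c : R) (i0 : nat) :
  Un_cv a A -> (forall i, (i0 <= i)%nat -> a i <= c) -> A <= c.
Proof.
  intros Ha H. apply le_epsilon; intros e He.
  destruct (Ha e He) as [n Hn]. specialize (Hn (max n i0) ltac:(lia)).
  specialize (H (max n i0) ltac:(lia)). unfold Rdist in Hn. apply Rabs_def2 in Hn. lra.
Qed.

Theorem mainTheorem9 (V : Type) (q : V -> V -> R) (N : V -> list V)
  (HV : @countable_type V)
  (Hq : forall x y, 0 <= q x y)
  (HN : neighbour_list q N)
  (Hrev : reversible q)
  (Hconn : connected q)
  (Hcurv : nonneg_ollivier q N)
  (qmin : R) (Hqmin : is_qmin q qmin)
  (f : V -> R) (Hbdd : exists B, forall x, Rabs (f x) <= B)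
  (normf : R) (Hnormf : is_lub (fun r => exists x, r = Rabs (f x)) normf)
  (t : R) (Ht : 0 < t)
  (Sq : nat -> V -> bool) (HS : exhaustion Sq)
  (Ptf : V -> R)
  (HPtf : forall x, Un_cv (fun i => heatS q N (Sq i) t f x) (Ptf x)) :
  0 < qmin ->
  forall x y, x <> y ->
    Rabs (grad q Ptf x y) <= normf / sqrt (t * qmin).
Proof.
  intros Hqm0 x0 y0 Hxy0.
  assert (Hsym : forall x y, q x y > 0 -> q y x > 0).
  { destruct Hrev as [m [Hm Hr]]. intros x y H.
    assert (Hx := Hm x). assert (Hy := Hm y). specialize (Hr x y).
    apply Rmult_lt_reg_r with (m y); [auto|]. rewrite Rmult_0_l, <- Hr.
    apply Rmult_lt_0_compat; auto. }
  assert (Hqm : forall x y, q x y > 0 -> qmin <= q x y).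
  { intros x y H. apply Hqmin. eauto. }
  assert (Hf : forall x, Rabs (f x) <= normf) by (intros x; apply Hnormf; eauto).
  assert (HK : 0 <= normf) by (eapply Rle_trans; [apply Rabs_pos|apply (Hf x0)]).
  assert (Hs : 0 < sqrt (t * qmin)) by (apply sqrt_lt_R0, Rmult_lt_0_compat; auto).
  assert (Hcore : forall x y, x <> y ->
            Ptf x - Ptf y <= normf * (INR (dist q x y) / sqrt (t * qmin))).
  { intros x y Hne.
    apply Rle_trans with (profile normf (scale qmin t) (dist q x y)).
    2:{ apply profile_le_linear; auto.
        - apply scale_ge_1; lra.
        - rewrite scale_eq by lra. rewrite pow2_sqrt by nra. ring.
        - apply dist_pos_R; auto. }
    set (D := lap q N (fun z => INR (dist q x z)) x).
    (* With base point [o = x], the total penalty at [(x, y)] and time [t] is [eps * C], which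
       [eps = e / C] makes equal to [e]. *)
    set (C := INR (dist q x x) + INR (dist q x y) + (2 * D + 1) * t).
    assert (HD : 0 <= D) by (apply lap_dist_nonneg; auto).
    assert (HC : 0 < C).
    { unfold C. assert (A := dist_pos_R q Hconn x y Hne).
      assert (B := pos_INR (dist q x x)). nra. }
    apply le_epsilon; intros e He.
    set (eps := e / C).
    assert (Heps : 0 < eps) by (apply Rdiv_lt_0_compat; auto).
    (* The ball of radius [r] contains every point where the penalty is at most [2 * normf]. It is
       fixed before the exhaustion index, so one bound holds for all [i >= i0]. *)
    assert (Hr : exists r, 2 * normf / eps < INR r).
    { destruct (INR_unbounded (2 * normf / eps)) as [r Hr]. exists r; auto. }
    destruct Hr as [r Hr].
    destruct (finite_ball q Hsym Hconn N HN x r) as [L HL].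
    destruct (exhaustion_contains_list Sq L HS) as [i0 Hi0].
    apply (Un_cv_le_eventually
      (fun i => heatS q N (Sq i) t f x - heatS q N (Sq i) t f y) _ _ i0).
    - apply CV_minus; apply HPtf.
    - intros i Hi. replace e with (eps * C) by (unfold eps; field; lra).
      destruct HS as [Hfin _].
      apply (heat_modulus q N Hq HN Hsym Hconn Hcurv qmin Hqm0 Hqm
        (fun s => heatS q N (Sq i) s f) L x normf eps D); auto; [| | |lra].
      + intros z Hz. apply HL, INR_le. left.
        apply Rle_lt_trans with (2 * normf / eps); [|auto].
        apply Rle_div_r; [auto|]. lra.
      + intros z s Hz. eapply heat_equation; eauto.
      + intros z s Hs'. apply heat_abs_le; auto. }
  assert (Hd := dist_pos_R q Hconn x0 y0 Hxy0).
  unfold grad. rewrite Rabs_div, (Rabs_right (INR _)) by lra.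
  apply Rle_div_l; [lra|].
  replace (normf / sqrt (t * qmin) * INR (dist q x0 y0))
    with (normf * (INR (dist q x0 y0) / sqrt (t * qmin))) by (field; lra).
  apply Rabs_le; split; [|auto].
  assert (A := Hcore y0 x0 (not_eq_sym Hxy0)).
  rewrite (dist_sym q Hsym Hconn y0 x0) in A. lra.
Qed.
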